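(* Let $\alpha\in(0,1)\setminus\mathbb{Q}$ have continued fraction partial quotients $(a_k)_{k\ge1}$ and convergent denominators $(q_k)_{k\ge -1}$, and put $q_k^*:=(-1)^kq_k$. For every integer $Z$ there exist $\ell\ge 0$ and a $(-\alpha)$-admissible finite digit sequence $(b_k)_{k=1}^{\ell}$ such that \[Z=\sum_{k=1}^{\ell} b_k\, q^*_{k-1},\] and this digit sequence is unique, where digit sequences differing only by trailing zeros are identified (equivalently, it is unique if one requires $b_\ell\neq0$ when $\ell\ge1$). For $Z=0$ the expansion is the empty one ($\ell=0$).
   Context: Write $\alpha=\cfrac{1}{a_1+\cfrac{1}{a_2+\cfrac{1}{a_3+\cdots}}}$ with positive integers $a_k$ (the partial quotients). The denominators of the convergents satisfy $q_{-1}:=0$, $q_0:=1$, $q_k=a_kq_{k-1}+q_{k-2}$ for $k\ge1$, and $q_k^*:=(-1)^kq_k$ for $k\ge -1$. A digit sequence $(b_k)_{k=1}^{\ell}$ of nonnegative integers is called $(-\alpha)$-admissible if: (i) $b_k\le a_k$ for all $k\ge1$; (ii) for every $k\ge1$, if $b_k=a_k$ then $b_{k+1}=0$ (with $b_{k}:=0$ for $k>\ell$). *)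

(* Defs.v *)
From mathcomp Require Import all_boot all_order all_algebra.
From mathcomp Require Import all_classical all_reals all_analysis.

Set Implicit Arguments.
Unset Strict Implicit.
Unset Printing Implicit Defensive.

Import Order.TTheory GRing.Theory Num.Theory.
Import numFieldNormedType.Exports.

Local Open Scope classical_set_scope.
Local Open Scope ring_scope.

(* Partial quotients are sequences a : nat -> nat read from index 1 on;
   the value a 0 is never used. *)

(* The finite continued fraction [0; a_1, ..., a_n]. *)
Definition cfrac (R : realType) (a : nat -> nat) (n : nat) : R :=
  foldr (fun (m : nat) (x : R) => (m%:R + x)^-1) 0 [seq a k | k <- iota 1 n].

Definition partial_quotients (R : realType) (alpha : R) (a : nat -> nat) : Prop :=
  (forall k : nat, (1 <= k)%N -> (0 < a k)%N) /\
  cfrac R a n @[n --> \oo] --> alpha.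

(* The pair (q_{k-1}, q_k), starting from (q_{-1}, q_0) = (0, 1). *)
Fixpoint qpair (a : nat -> nat) (k : nat) : nat * nat :=
  if k is k'.+1 then
    let: (q'', q') := qpair a k' in (q', (a k * q' + q'')%N)
  else (0%N, 1%N).

Definition q (a : nat -> nat) (k : nat) : nat := (qpair a k).2.

Definition qstar (a : nat -> nat) (k : nat) : int := (-1) ^+ k * (q a k)%:Z.

(* b_k for k >= 1; the list is 0-based, and b_k = 0 for k > size b. *)
Definition digit (b : seq nat) (k : nat) : nat := nth 0%N b k.-1.

Definition admissible (a : nat -> nat) (b : seq nat) : Prop :=
  (forall k : nat, (1 <= k)%N -> (digit b k <= a k)%N) /\
  (forall k : nat, (1 <= k)%N -> digit b k = a k -> digit b k.+1 = 0%N).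

Definition expansion (a : nat -> nat) (Z : int) (b : seq nat) : Prop :=
  admissible a b /\
  Z = \sum_(1 <= k < (size b).+1) (digit b k)%:Z * qstar a k.-1.

Definition reduced (b : seq nat) : Prop :=
  (1 <= size b)%N -> digit b (size b) <> 0%N.

(* Main.v *)
(** Write [q_{-1} = 0].  The admissible digit sequences of length [n] represent
    exactly the integers of the half-open interval [(-q_{n-1}, q_n]] ([n] odd)
    or [(-q_n, q_{n-1}]] ([n] even), each of them once.  Those with [b_n < a_n]
    fill the subinterval of length [q_n] obtained by cutting off [q_{n-1}]
    integers at the end on the side of the sign of [q*_{n-1}].  This goes by
    induction: the interval of level [n + 1] is the disjoint union of the
    interval of level [n] (digit [b_{n+1} = 0]) and of the translates by
    [j q*_n], [1 <= j <= a_{n+1}], of the subinterval of level [n].  The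
    intervals exhaust the integers as [n] grows. *)
Require Import Defs.
From mathcomp Require Import all_boot all_order all_algebra.
From mathcomp Require Import all_classical all_reals all_analysis.
From mathcomp Require Import zify.
Import Order.TTheory GRing.Theory Num.Theory.
Import numFieldNormedType.Exports.
Local Open Scope classical_set_scope.
Local Open Scope ring_scope.

(** * Growth and signs of the convergent denominators *)

Definition qprev (a : nat -> nat) (k : nat) : nat := (qpair a k).1.

Lemma qprevS (a : nat -> nat) (n : nat) : qprev a n.+1 = q a n.
Proof. by rewrite /qprev /q /=; case: (qpair a n). Qed.

Lemma qS (a : nat -> nat) (n : nat) :
  q a n.+1 = (a n.+1 * q a n + qprev a n)%N.
Proof. by rewrite /qprev /q /=; case: (qpair a n). Qed.

Lemma q_bounds (a : nat -> nat) (n : nat) :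
  (forall k, (1 <= k)%N -> (0 < a k)%N) ->
  [/\ (qprev a n <= q a n)%N, (n <= q a n)%N & (0 < q a n)%N].
Proof.
(* Positivity of [qprev] joins the induction because it makes the growth strict from $q_1$ on; the
   first step can be an equality, $q_0=q_1=1$. *)
move=> a_gt0; suff: (qprev a n <= q a n /\ n <= q a n /\ 0 < q a n
    /\ (0 < n -> 0 < qprev a n))%N by case=> ? [? []].
elim: n => [|n [IH1 [IH2 [IH3 IH4]]]]; first by [].
have := a_gt0 n.+1 isT; rewrite qS qprevS => an.
have := leq_pmull (q a n) an.
case: n IH4 {IH1 an} IH2 IH3 => [|n] IH4 IH2 IH3; first by lia.
by have := IH4 isT; lia.
Qed.

Lemma qstarE (a : nat -> nat) (n : nat) :
  qstar a n = if odd n then - (q a n)%:Z else (q a n)%:Z.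
Proof. by rewrite /qstar -signr_odd; case: (odd n) => /=; lia. Qed.

(** * Intervals and truncated expansions *)

Definition in_range (a : nat -> nat) (n : nat) (Z : int) : bool :=
  if odd n then - (qprev a n)%:Z < Z <= (q a n)%:Z
  else - (q a n)%:Z < Z <= (qprev a n)%:Z.

Definition in_subrange (a : nat -> nat) (n : nat) (Z : int) : bool :=
  if odd n then - (qprev a n)%:Z < Z <= (q a n)%:Z - (qprev a n)%:Z
  else (qprev a n)%:Z - (q a n)%:Z < Z <= (qprev a n)%:Z.

Definition value (a f : nat -> nat) (n : nat) : int :=
  \sum_(1 <= k < n.+1) (f k)%:Z * qstar a k.-1.

Definition adm_upto (a f : nat -> nat) (n : nat) : Prop :=
  (forall k, (1 <= k <= n)%N -> (f k <= a k)%N) /\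
  (forall k, (1 <= k < n)%N -> f k = a k -> f k.+1 = 0%N).

Lemma valueS (a f : nat -> nat) (n : nat) :
  value a f n.+1 = value a f n + (f n.+1)%:Z * qstar a n.
Proof. by rewrite /value big_nat_recr. Qed.

Lemma value0 (a f : nat -> nat) : value a f 0 = 0.
Proof. by rewrite /value big_geq. Qed.

Lemma eq_value (a f g : nat -> nat) (n : nat) :
  (forall k, (1 <= k <= n)%N -> f k = g k) -> value a f n = value a g n.
Proof. by move=> fg; apply: eq_big_nat => k kn; rewrite fg. Qed.

Lemma adm_uptoW (a f : nat -> nat) (n : nat) :
  adm_upto a f n.+1 -> adm_upto a f n.
Proof. by case=> f1 f2; split=> k kn; [apply: f1|apply: f2]; lia. Qed.

(** Rule (ii) read backwards. It puts the prefix below a nonzero top digit in the subrange. *)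
Lemma adm_upto_prev (a f : nat -> nat) (n : nat) :
  adm_upto a f n.+1 -> (0 < f n.+1)%N -> (0 < n)%N -> (f n < a n)%N.
Proof.
case=> f1 f2 fn n0; have := f1 n ltac:(lia).
rewrite leq_eqVlt => /orP[/eqP /f2 f0|//].
by rewrite f0 ?n0 ?leqnn in fn.
Qed.

Lemma value_range (a f : nat -> nat) (n : nat) :
  (forall k, (1 <= k)%N -> (0 < a k)%N) -> adm_upto a f n ->
  in_range a n (value a f n) /\
  (((0 < n)%N -> (f n < a n)%N) -> in_subrange a n (value a f n)).
Proof.
move=> a_gt0; elim: n => [|n IH] admf; first by rewrite value0.
have [IHr IHs] := IH (adm_uptoW _ _ _ admf).
have [pq _ q0] := q_bounds a n a_gt0.
have fa : (f n.+1 <= a n.+1)%N by case: admf => + _; apply; lia.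
have an := a_gt0 n.+1 isT.
rewrite valueS qstarE.
case: (posnP (f n.+1)) => [f0|f_gt0].
  (* The range of level [n] lies in the subrange of level [n.+1], since $q_{n+1}-q_n\ge q_{n-1}$. *)
  rewrite f0 mul0r addr0; move: {IH IHs} IHr.
  rewrite /in_range /in_subrange /= qS qprevS.
  by case: (odd n) => /=; nia.
have := IHs (adm_upto_prev _ _ _ admf f_gt0) => {IH IHs IHr}.
rewrite /in_range /in_subrange /= qS qprevS.
have le1 : ((f n.+1) * q a n <= a n.+1 * q a n)%N by rewrite leq_mul2r fa orbT.
have le2 : (q a n <= f n.+1 * q a n)%N by rewrite leq_pmull.
(* A top digit below its maximum leaves room for one more $q_n$, the piece cut off from the
   range. *)
have le3 : (f n.+1 < a n.+1 -> (f n.+1) * q a n + q a n <= a n.+1 * q a n)%N.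
  by move=> fa'; rewrite addnC -mulSn leq_mul2r fa' orbT.
by case: (odd n) => /= ?; split => [|/(_ isT)/le3]; lia.
Qed.

Lemma value_inj (a f g : nat -> nat) (n : nat) :
  (forall k, (1 <= k)%N -> (0 < a k)%N) ->
  adm_upto a f n -> adm_upto a g n -> value a f n = value a g n ->
  forall k, (1 <= k <= n)%N -> f k = g k.
Proof.
move=> a_gt0; elim: n => [|n IH] admf admg; first by move=> _ [|k].
have [af ag] := (adm_uptoW _ _ _ admf, adm_uptoW _ _ _ admg).
have [_ _ q0] := q_bounds a n a_gt0.
rewrite !valueS => eqv.
have [fr fs] := value_range a f n a_gt0 af.
have [gr gs] := value_range a g n a_gt0 ag.
(* Equal top digits cancel, and the induction hypothesis handles the prefixes. *)
suff fg : f n.+1 = g n.+1.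
  move: eqv; rewrite fg => /addIr /(IH af ag) fgk k kn.
  have [->//|kn1] := eqVneq k n.+1; apply: fgk; lia.
move: eqv; rewrite qstarE.
have := adm_upto_prev _ _ _ admf; have := adm_upto_prev _ _ _ admg.
move: (f n.+1) (g n.+1) => j j' {IH admf admg}.
case: (posnP j) => [->|j0]; case: (posnP j') => [->|j'0] //.
(* Shifted by at least $q_n$ in the direction of $q^*_n$, the subrange is disjoint from the
   range. *)
- move=> /(_ isT)/gs {}gs _; move: fr gs.
  have : (q a n <= j' * q a n)%N by rewrite leq_pmull.
  by rewrite /in_range /in_subrange; case: (odd n); lia.
- move=> _ /(_ isT)/fs {}fs; move: gr fs.
  have : (q a n <= j * q a n)%N by rewrite leq_pmull.
  by rewrite /in_range /in_subrange; case: (odd n); lia.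
move=> /(_ isT)/gs {}gs /(_ isT)/fs {}fs eqv.
(* Both prefixes lie among the $q_n$ consecutive integers of the subrange, so they cannot differ by
   a nonzero multiple of $q_n$. *)
have lt_mul i i' : (i < i')%N -> (i * q a n + q a n <= i' * q a n)%N.
  by move=> ii'; rewrite addnC -mulSn leq_mul2r ii' orbT.
case: (ltngtP j j') => // /lt_mul; move: fs gs eqv;
  by rewrite /in_subrange; case: (odd n); lia.
Qed.

(** * Every integer of the range is represented *)

Lemma range_split (a : nat -> nat) (n : nat) (Z : int) :
  (0 < q a n)%N -> in_range a n.+1 Z ->
  in_range a n Z \/
  exists j : nat, [/\ (0 < j <= a n.+1)%N,
    in_subrange a n (Z - j%:Z * qstar a n) &
    in_subrange a n.+1 Z -> (j < a n.+1)%N].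
Proof.
move=> q0; have [Zr|Zr Zr1] := boolP (in_range a n Z); [by left|right].
(* [u] counts the integers strictly between [Z] and the range of level [n]; the [j]-th translate is
   where $(j-1)q_n\le u<jq_n$. The parities differ by 1 because the intervals are open on the left
   only. *)
pose u := if odd n then absz (Z + (qprev a n)%:Z)%R
          else absz (Z - (qprev a n)%:Z - 1)%R.
exists (u %/ q a n).+1; move: Zr Zr1.
have du := divn_eq u (q a n); have ru := ltn_pmod u q0.
(* For the digit [j] chosen above, [i = 0] will give $j\le a_{n+1}$ and [i = 1] the strict bound on
   the subrange. *)
have dlt i : (u + i * q a n < a n.+1 * q a n)%N -> (u %/ q a n + i < a n.+1)%N.
  by rewrite (addnC u) (addnC (u %/ _)%N) -divnMDl // ltn_divLR.
have := dlt 0%N; have := dlt 1%N; rewrite mul0n mul1n.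
rewrite /in_range /in_subrange /= qS qprevS qstarE.
move: du ru; move: (u %/ q a n)%N (u %% q a n)%N => d r {dlt}.
rewrite {}/u; case: (odd n) => /= du ru hd1 hd hr hr1; split; lia.
Qed.

(** The last clause is what allows a positive digit to be appended at the next level without
    breaking rule (ii). *)
Lemma range_value (a : nat -> nat) (n : nat) (Z : int) :
  (forall k, (1 <= k)%N -> (0 < a k)%N) -> in_range a n Z ->
  exists f, [/\ adm_upto a f n, value a f n = Z &
    in_subrange a n Z -> (0 < n)%N -> (f n < a n)%N].
Proof.
move=> a_gt0; elim: n Z => [|n IH] Z.
  rewrite /in_range /q /qprev /= => Z0; exists (fun=> 0%N).
  by rewrite value0; split; [split=> k; lia|lia|].
have [_ _ q0] := q_bounds a n a_gt0.
have extend f j : adm_upto a f n -> (j <= a n.+1)%N ->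
    ((0 < j)%N -> (0 < n)%N -> (f n < a n)%N) ->
    let g := fun k => if k == n.+1 then j else f k in
    adm_upto a g n.+1 /\ value a g n.+1 = value a f n + j%:Z * qstar a n.
  move=> [f1 f2] jn fj g; split.
    split=> k kn; rewrite /g.
      by case: eqP => [->//|/eqP ?]; apply: f1; lia.
    have -> : (k == n.+1) = false by lia.
    case: eqP => [[kE] fk|/eqP ?]; last by apply: f2; lia.
    by case: (posnP j) fj => // j0; subst k; rewrite fk; lia.
  rewrite valueS /g eqxx; congr (_ + _); apply: eq_value => k kn.
  by have -> : (k == n.+1) = false by lia.
move=> /(range_split _ _ _ q0) [/IH[f [af fZ _]]|[j [jn Zs jlt]]].
  have [//|//|ag gZ] := extend f 0%N af.
  exists (fun k => if k == n.+1 then 0%N else f k); split=> //.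
    by rewrite gZ fZ mul0r addr0.
  by rewrite eqxx => _ _; apply: a_gt0.
have /IH[f [af fZ fs]] : in_range a n (Z - j%:Z * qstar a n).
  by move: Zs; rewrite /in_range /in_subrange; case: (odd n); lia.
have [|_|ag gZ] := extend f j af; [by lia|exact: fs|].
exists (fun k => if k == n.+1 then j else f k); split=> //.
  by rewrite gZ fZ subrK.
by rewrite eqxx => /jlt.
Qed.

(** At this level both $q_{n-1}$ and $q_n$ are at least $|Z|+1$, enough for the strict left end. *)
Lemma in_range_large (a : nat -> nat) (Z : int) :
  (forall k, (1 <= k)%N -> (0 < a k)%N) -> in_range a (absz Z).+2 Z.
Proof.
move=> a_gt0.
have [pq _ _] := q_bounds a (absz Z).+2 a_gt0.
have [_ nq _] := q_bounds a (absz Z).+1 a_gt0.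
by move: pq; rewrite /in_range qprevS; case: ifP; lia.
Qed.

(** * From digit functions to finite lists *)

Lemma digit_default (b : seq nat) (k : nat) : (size b < k)%N -> digit b k = 0%N.
Proof. by case: k => // k bk; rewrite /digit nth_default. Qed.

Lemma value_digit (a : nat -> nat) (b : seq nat) (n : nat) :
  (size b <= n)%N ->
  \sum_(1 <= k < (size b).+1) (digit b k)%:Z * qstar a k.-1 =
  value a (digit b) n.
Proof.
move=> bn; rewrite /value [RHS](big_cat_nat _ (n := (size b).+1)) //=.
rewrite [X in _ = _ + X]big_nat_cond [X in _ = _ + X]big1 ?addr0 // => k.
by rewrite andbT => /andP[bk _]; rewrite digit_default ?mul0r.
Qed.

Lemma expansion_exists (a : nat -> nat) (Z : int) :
  (forall k, (1 <= k)%N -> (0 < a k)%N) -> exists b, expansion a Z b.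
Proof.
move=> a_gt0; have := in_range_large a Z a_gt0.
move=> /(range_value _ _ _ a_gt0)[f [[f1 f2] <- _]].
set n := (absz Z).+2 in f1 f2 *.
pose b := mkseq (fun i => f i.+1) n.
have sb : size b = n by rewrite size_mkseq.
have bf k : (1 <= k <= n)%N -> digit b k = f k.
  by case: k => // k /= kn; rewrite /digit nth_mkseq.
exists b; split; last first.
  rewrite (value_digit _ _ n) ?sb //; apply: eq_value => k kn.
  by rewrite bf.
split=> k k1; have [kn|kn] := leqP k n.
- by rewrite bf ?k1 // f1 // k1.
- by rewrite digit_default ?sb.
(* At [k = n], where [f2] is silent, rule (ii) holds by the default digit 0. *)
- have [kn'|kn'] := ltnP k n; last by rewrite [digit b k.+1]digit_default ?sb.
  by rewrite !bf ?k1 //; apply: f2; rewrite k1.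
- by rewrite [digit b k.+1]digit_default ?sb //; lia.
Qed.

Lemma expansion_unique (a : nat -> nat) (Z : int) (b c : seq nat) :
  (forall k, (1 <= k)%N -> (0 < a k)%N) ->
  expansion a Z b -> expansion a Z c ->
  forall k, (1 <= k)%N -> digit b k = digit c k.
Proof.
move=> a_gt0 [[b1 b2] bZ] [[c1 c2] cZ] k k1.
(* A common level that covers both lists and the position [k]. *)
pose n := maxn (maxn (size b) (size c)) k.
apply: (value_inj a _ _ n a_gt0); [split| split| |rewrite k1 /n; lia].
- by move=> i /andP[i1 _]; apply: b1.
- by move=> i /andP[i1 _]; apply: b2.
- by move=> i /andP[i1 _]; apply: c1.
- by move=> i /andP[i1 _]; apply: c2.
by rewrite -!value_digit /n -?bZ -?cZ //; lia.
Qed.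

(** * Trailing zeros and reduced sequences *)

Lemma digit_rcons0 (b : seq nat) (k : nat) : digit (rcons b 0) k = digit b k.
Proof.
rewrite /digit nth_rcons; case: ltnP => // bk.
by rewrite nth_default //; case: eqP.
Qed.

Lemma expansion_rcons0 (a : nat -> nat) (Z : int) (b : seq nat) :
  expansion a Z (rcons b 0) -> expansion a Z b.
Proof.
move=> [[b1 b2] ->]; split.
  by split=> k k1; have := b1 k k1; have := b2 k k1; rewrite !digit_rcons0.
rewrite (value_digit _ b (size (rcons b 0%N))) ?size_rcons //.
by apply: eq_value => k _; rewrite digit_rcons0.
Qed.

Lemma expansion_reduced (a : nat -> nat) (Z : int) (b : seq nat) :
  expansion a Z b -> exists c, expansion a Z c /\ reduced c.
Proof.
elim/last_ind: b => [|b x IH] ex; first by exists [::].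
case: x ex => [/expansion_rcons0/IH //|x ex].
exists (rcons b x.+1); split=> // _.
by rewrite /digit size_rcons /= nth_rcons ltnn eqxx.
Qed.

(** The nonzero last digit of [b] cannot sit beyond the end of [c], where digits default to 0. *)
Lemma reduced_size_le (b c : seq nat) :
  reduced b -> (forall k, (1 <= k)%N -> digit b k = digit c k) ->
  (size b <= size c)%N.
Proof.
move=> redb bc; rewrite leqNgt; apply/negP => cb.
have b1 : (1 <= size b)%N by lia.
by apply: (redb b1); rewrite bc // digit_default.
Qed.

Lemma reduced_inj (b c : seq nat) :
  reduced b -> reduced c -> (forall k, (1 <= k)%N -> digit b k = digit c k) ->
  b = c.
Proof.
move=> redb redc bc; apply: (@eq_from_nth _ 0%N) => [|i _]; last exact: bc i.+1 _.
apply/eqP; rewrite eqn_leq !reduced_size_le // => k k1.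
by rewrite bc.
Qed.

Theorem theorem2 (R : realType) (alpha : R) (a : nat -> nat)
    (alpha01 : 0 < alpha < 1) (alpha_irr : irrational alpha)
    (alpha_a : partial_quotients alpha a) :
  (forall Z : int,
     (exists b : seq nat, expansion a Z b) /\
     (forall b c : seq nat, expansion a Z b -> expansion a Z c ->
        forall k : nat, (1 <= k)%N -> digit b k = digit c k) /\
     (exists! b : seq nat, expansion a Z b /\ reduced b)) /\
  (forall b : seq nat, expansion a 0 b /\ reduced b <-> b = [::]).
Proof.
have [a_gt0 _] := alpha_a.
have uniq_red Z b c : expansion a Z b /\ reduced b ->
    expansion a Z c /\ reduced c -> b = c.
  move=> [eb rb] [ec rc]; apply: reduced_inj => //.
  exact: expansion_unique eb ec.
split=> [Z|b].
  have [b eb] := expansion_exists a Z a_gt0.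
  split; first by exists b.
  split; first by move=> ? ?; apply: expansion_unique.
  have [c ec] := expansion_reduced a Z b eb.
  by exists c; split=> // d; apply: uniq_red.
have nil0 : expansion a 0 [::] /\ reduced [::].
  split=> //; split; last by rewrite big_geq.
  by split=> [k|[|k] _ _]; rewrite /digit ?nth_nil.
by split=> [eb|->//]; apply: uniq_red eb nil0.
Qed.
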